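(* Let $A\in SL(\mathbb{Z},2)$ be diagonalizable over the complex field, with all eigenvalues of modulus $1$. Let $\mathbf{c}=(c_n)_{n\ge1}$ be an oscillating sequence of complex numbers satisfying the growth condition $\sum_{n=1}^N|c_n|^\lambda=O(N)$ for some $\lambda>1$. Then for every $\mathbf{b}\in\mathbb{T}^2$, $\mathbf{c}$ is linearly disjoint from the flow $\mathcal{X}=(\mathbb{T}^2,\ T\mathbf{x}=A\mathbf{x}+\mathbf{b})$.
   Context: $\mathbb{T}^2=\mathbb{R}^2/\mathbb{Z}^2$ with its standard metric. $SL(\mathbb{Z},2)$ denotes the set of $2\times2$ integer matrices $A$ with $\det A=\pm1$. A sequence $(c_n)_{n\ge1}$ of complex numbers is oscillating if $\lim_{N\to\infty}\frac1N\sum_{n=1}^N c_n e^{-2\pi i n t}=0$ for every $t\in[0,1)$. For a compact metric space $X$ and a continuous map $T:X\to X$, $(c_n)$ is linearly disjoint from the flow $(X,T)$ if $\lim_{N\to\infty}\frac1N\sum_{n=1}^N c_n f(T^n x)=0$ for every continuous $f:X\to\mathbb{C}$ and every $x\in X$. *)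

(* Defs.v *)
From HB Require Import structures.
From mathcomp Require Import all_boot all_order all_algebra.
From mathcomp Require Import generic_quotient ring_quotient complex.
From mathcomp Require Import all_classical all_reals all_analysis.
From mathcomp Require Import ring lra.
Import Order.TTheory GRing.Theory Num.Theory.
Import numFieldNormedType.Exports.

Set Implicit Arguments.
Unset Strict Implicit.
Unset Printing Implicit Defensive.

Local Open Scope classical_set_scope.
Local Open Scope ring_scope.
Local Open Scope quotient_scope.
Local Open Scope complex_scope.

(* numFieldNormedType.Exports topologizes variables K : numClosedFieldType by
   the modulus, but not the concrete type R[i]. *)
HB.instance Definition _ (R : rcfType) := NormedModule.copy R[i] (R[i]^o).

Section Torus.
Variable R : realType.

Definition int_lattice : {pred 'cV[R]_2} :=
  fun v => [forall i, v i 0 \is a Num.int].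

Fact int_lattice_zmod : zmod_closed int_lattice.
Proof.
split=> [|u v /forallP uZ /forallP vZ]; apply/forallP => i.
  by rewrite mxE rpred0.
by rewrite !mxE rpredB.
Qed.

HB.instance Definition _ :=
  GRing.isZmodClosed.Build 'cV[R]_2 int_lattice int_lattice_zmod.

Definition torus : Type := @Quotient.quot 'cV[R]_2 int_lattice.

HB.instance Definition _ := Choice.on torus.
HB.instance Definition _ := GRing.Zmodule.on torus.
HB.instance Definition _ := EqQuotient.on torus.

Lemma torus_piD (u v : 'cV[R]_2) :
  \pi_torus (u + v) = \pi_torus u + \pi_torus v.
Proof. by rewrite piE. Qed.

Lemma torus_piN (u : 'cV[R]_2) : \pi_torus (- u) = - \pi_torus u.
Proof. by rewrite piE. Qed.

Lemma torus_pi0 : \pi_torus 0 = 0.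
Proof. by rewrite piE. Qed.

Lemma torus_piB (u v : 'cV[R]_2) :
  \pi_torus (u - v) = \pi_torus u - \pi_torus v.
Proof. by rewrite torus_piD torus_piN. Qed.

Lemma torus_pi_eqP (u v : 'cV[R]_2) :
  reflect (\pi_torus u = \pi_torus v) (u - v \in int_lattice).
Proof. by rewrite (Quotient.idealrBE int_lattice); exact: eqP. Qed.

Definition euclid_norm (v : 'cV[R]_2) : R :=
  Num.sqrt (v 0 0 ^+ 2 + v 1 0 ^+ 2).

Lemma euclid_normE (v : 'cV[R]_2) :
  euclid_norm v = Normc.normc (v 0 0 +i* v 1 0).
Proof. by []. Qed.

Lemma euclid_norm_ge0 v : 0 <= euclid_norm v.
Proof. exact: sqrtr_ge0. Qed.

Lemma euclid_norm0 : euclid_norm 0 = 0.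
Proof. by rewrite /euclid_norm !mxE expr0n addr0 sqrtr0. Qed.

Lemma euclid_normN v : euclid_norm (- v) = euclid_norm v.
Proof. by rewrite /euclid_norm !mxE !sqrrN. Qed.

Lemma euclid_normD u v : euclid_norm (u + v) <= euclid_norm u + euclid_norm v.
Proof. by rewrite !euclid_normE !mxE; exact: le_normcD (_ +i* _) (_ +i* _). Qed.

Lemma euclid_norm_coord (v : 'cV[R]_2) i : `|v i 0| <= euclid_norm v.
Proof.
rewrite -sqrtr_sqr /euclid_norm; apply: ler_wsqrtr.
have [->|->] : i = 0 \/ i = 1.
- by case: i => -[|[|//]] ?; [left|right]; exact/val_inj.
- by rewrite lerDl sqr_ge0.
- by rewrite lerDr sqr_ge0.
Qed.

Lemma euclid_norm_le (v : 'cV[R]_2) : euclid_norm v <= `|v 0 0| + `|v 1 0|.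
Proof.
rewrite -[leRHS]ger0_norm ?addr_ge0// -sqrtr_sqr; apply: ler_wsqrtr.
rewrite -(real_normK (num_real (v 0 0))) -(real_normK (num_real (v 1 0))).
have := normr_ge0 (v 0 0); have := normr_ge0 (v 1 0); nra.
Qed.

Lemma euclid_norm_eq0 v : euclid_norm v = 0 -> v = 0.
Proof.
move=> v0; apply/colP => i; rewrite mxE; apply/normr0_eq0/eqP.
by rewrite eq_le normr_ge0 andbT -v0 euclid_norm_coord.
Qed.

Lemma int_lattice_small v : v \in int_lattice -> euclid_norm v < 1 -> v = 0.
Proof.
move=> /forallP vZ v1; apply/colP => i; rewrite mxE.
have /intrP[m vm] := vZ i.
have := le_lt_trans (euclid_norm_coord v i) v1.
rewrite vm -intr_norm -[1]/(1%:~R) ltr_int => m1.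
suff -> : m = 0 by [].
by move: m1; case: m {vm} => -[].
Qed.

(* The quotient of the Euclidean metric: the least length of a vector from a
   point over y to a point over x. *)
Definition torus_dist (x y : torus) : R :=
  inf [set euclid_norm v | v in [set v | \pi_torus v = x - y]].

Let lifts_has_inf (x y : torus) :
  has_inf [set euclid_norm v | v in [set v | \pi_torus v = x - y]].
Proof.
split; last by exists 0 => _ [v _ <-]; exact: euclid_norm_ge0.
by exists (euclid_norm (repr (x - y))), (repr (x - y)) => //=; rewrite reprK.
Qed.

Lemma torus_dist_le x y v :
  \pi_torus v = x - y -> torus_dist x y <= euclid_norm v.
Proof. by move=> vxy; apply: ge_inf; [case: (lifts_has_inf x y)|exists v]. Qed.

Lemma torus_dist_lt x y e : torus_dist x y < e ->
  exists2 v, \pi_torus v = x - y & euclid_norm v < e.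
Proof.
rewrite -subr_gt0 => /inf_adherent /(_ (lifts_has_inf x y)) [_ [v vxy <-]].
by rewrite -/(torus_dist x y) addrC subrK; exists v.
Qed.

Lemma torus_dist_ge0 x y : 0 <= torus_dist x y.
Proof.
apply: lb_le_inf; first by case: (lifts_has_inf x y).
by move=> _ [v _ <-]; exact: euclid_norm_ge0.
Qed.

Lemma torus_distxx x : torus_dist x x = 0.
Proof.
apply/eqP; rewrite eq_le torus_dist_ge0 andbT -euclid_norm0.
by apply: torus_dist_le; rewrite torus_pi0 subrr.
Qed.

Lemma torus_dist_positivity x y : torus_dist x y = 0 -> x = y.
Proof.
move=> xy0; have half0 : 0 < 2^-1 :> R by rewrite invr_gt0.
have [v vxy v1] : exists2 v, \pi_torus v = x - y & euclid_norm v < 2^-1.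
  by apply: torus_dist_lt; rewrite xy0.
have [v0|v0] := eqVneq (euclid_norm v) 0.
  by apply/eqP; rewrite -subr_eq0 -vxy (euclid_norm_eq0 v0) torus_pi0.
have [w wxy wv] : exists2 w, \pi_torus w = x - y & euclid_norm w < euclid_norm v.
  by apply: torus_dist_lt; rewrite xy0 lt_neqAle eq_sym v0 euclid_norm_ge0.
suff /eqP : v - w = 0 by rewrite subr_eq0 => /eqP vw; rewrite vw ltxx in wv.
apply: int_lattice_small; first by apply/torus_pi_eqP; rewrite vxy.
rewrite (le_lt_trans (euclid_normD _ _))// euclid_normN; lra.
Qed.

Lemma torus_dist_sym x y : torus_dist x y = torus_dist y x.
Proof.
congr inf; apply/seteqP; split=> _ [v vxy <-]; exists (- v); rewrite ?euclid_normN//=.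
  by rewrite torus_piN vxy opprB.
by rewrite torus_piN vxy opprB.
Qed.

Lemma torus_dist_triangle y x z :
  torus_dist x z <= torus_dist x y + torus_dist y z.
Proof.
apply/ler_addgt0Pl => e e0; have e20 : 0 < e / 2 by rewrite divr_gt0.
have [|u uxy ue] := @torus_dist_lt x y (torus_dist x y + e / 2).
  by rewrite ltrDl.
have [|v vyz ve] := @torus_dist_lt y z (torus_dist y z + e / 2).
  by rewrite ltrDl.
have uv : \pi_torus (u + v) = x - z by rewrite torus_piD uxy vyz addrA subrK.
rewrite (le_trans (torus_dist_le uv))// (le_trans (euclid_normD _ _))//; lra.
Qed.

HB.instance Definition _ := isMetric.Build R torus torus_distxx
  torus_dist_positivity torus_dist_sym torus_dist_triangle.

Lemma torus_mdist_pi_le (u v : 'cV[R]_2) :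
  mdist (\pi_torus u) (\pi_torus v) <= euclid_norm (u - v).
Proof. by apply: torus_dist_le; rewrite torus_piB. Qed.

Let lipschitz2_continuous (V : normedModType R) (f : V -> torus) :
  (forall u v, mdist (f u) (f v) <= `|u - v| + `|u - v|) -> continuous f.
Proof.
move=> f2 u; apply/metricType_numDomainType.cvgrPdist_lt => e e0.
apply/nbhs_normP; exists (e / 2); first by rewrite /= divr_gt0.
by move=> v /= uv; have := f2 u v; lra.
Qed.

Let euclid_norm_sup (v : 'cV[R]_2) : euclid_norm v <= `|v| + `|v|.
Proof.
have coord i : `|v i 0| <= `|v|.
  by rewrite [leRHS]/Num.norm/= mx_normrE (le_bigmax _ _ (i, 0)).
by rewrite (le_trans (euclid_norm_le v))// lerD.
Qed.

Lemma torus_pi_continuous : continuous (\pi_torus : 'cV[R]_2 -> torus).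
Proof.
apply: lipschitz2_continuous => u v.
exact: le_trans (torus_mdist_pi_le _ _) (euclid_norm_sup _).
Qed.

Lemma torus_compact : compact [set: torus].
Proof.
have cS : compact [set v : 'rV[R]_2 | forall i, `[0, 1]%classic (v ord0 i)].
  by have := @rV_compact R 2 (fun=> `[0, 1]%classic) (fun=> @segment_compact R 0 1).
pose f (v : 'rV[R]_2) := \pi_torus v^T.
have fc : continuous f.
  apply: lipschitz2_continuous => u v.
  apply: le_trans (torus_mdist_pi_le _ _) _.
  apply: le_trans (euclid_norm_le _) _.
  have coord i : `|(u^T - v^T) i 0| <= `|u - v|.
    rewrite [leRHS]/Num.norm/= mx_normrE.
    by rewrite !mxE; apply: le_trans (le_bigmax _ _ (0, i)); rewrite /= !mxE.
  by rewrite lerD.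
have <- : f @` [set v : 'rV[R]_2 | forall i, `[0, 1]%classic (v ord0 i)] = [set: torus].
  apply/seteqP; split=> // x _.
  pose w := repr x; pose n : 'cV[R]_2 := \col_i (Num.floor (w i 0))%:~R.
  exists (w - n)^T.
    move=> i /=; rewrite !mxE in_itv/=.
    by have := floor_itv (w i 0); rewrite intrD1; lra.
  rewrite /f trmxK -[RHS]reprK; apply/torus_pi_eqP.
  by rewrite addrC addKr; apply/forallP => i; rewrite !mxE rpredN intr_int.
apply: continuous_compact cS; exact: continuous_subspaceT.
Qed.

Definition torus_mulmx (A : 'M[int]_2) (x : torus) : torus :=
  \pi_torus (map_mx intr A *m repr x).

Lemma torus_mulmx_pi (A : 'M[int]_2) (v : 'cV[R]_2) :
  torus_mulmx A (\pi_torus v) = \pi_torus (map_mx intr A *m v).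
Proof.
apply/torus_pi_eqP; rewrite -mulmxBr.
have /torus_pi_eqP/forallP wZ : \pi_torus (repr (\pi_torus v)) = \pi_torus v.
  by rewrite reprK.
apply/forallP => i; rewrite mxE rpred_sum// => j _.
by rewrite mxE rpredM ?intr_int.
Qed.

Definition torus_affine (A : 'M[int]_2) (b x : torus) : torus :=
  torus_mulmx A x + b.

Let lipschitz_continuous (V W : metricType R) (f : V -> W) (K : R) : 0 < K ->
  (forall x y, mdist (f x) (f y) <= K * mdist x y) -> continuous f.
Proof.
move=> K0 fK x; apply/metricType_numDomainType.cvgrPdist_lt => e e0.
apply/metricType_numDomainType.nbhs_mdistP; exists (e / K).
  by rewrite /= divr_gt0.
by move=> y /= xy; rewrite (le_lt_trans (fK _ _))// mulrC -ltr_pdivlMr.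
Qed.

Lemma torus_affine_continuous A b : continuous (torus_affine A b).
Proof.
pose K : R := 1 + \sum_i \sum_j `|(A i j)%:~R|.
have K0 : 0 < K.
  by rewrite ltr_pwDl// sumr_ge0// => i _; rewrite sumr_ge0.
apply: (@lipschitz_continuous torus torus _ K K0) => x y.
rewrite -ler_pdivrMl//; apply: lb_le_inf; first by case: (lifts_has_inf x y).
move=> _ [v vxy <-]; rewrite ler_pdivrMl//.
have Avxy : \pi_torus (map_mx intr A *m v) =
    torus_affine A b x - torus_affine A b y.
  rewrite /torus_affine opprD addrACA subrr addr0 -torus_mulmx_pi vxy.
  by rewrite -[x]reprK -[y]reprK -torus_piB !torus_mulmx_pi mulmxBr torus_piB.
apply: (le_trans (torus_dist_le Avxy)).
apply: (le_trans (euclid_norm_le _)); rewrite /K mulrDl mul1r.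
rewrite -[leLHS]add0r lerD ?euclid_norm_ge0//.
have row i : `|(map_mx intr A *m v) i 0| <=
    (\sum_j `|(A i j)%:~R|) * euclid_norm v.
  rewrite mxE (le_trans (ler_norm_sum _ _ _))// mulr_suml ler_sum// => j _.
  by rewrite normrM mxE ler_wpM2l// euclid_norm_coord.
have sum2 (F : 'I_2 -> R) : \sum_i F i = F 0 + F 1.
  by rewrite big_ord_recl big_ord1; congr (_ + F _); exact/val_inj.
by rewrite (sum2 (fun i => \sum_j _)) mulrDl lerD ?row.
Qed.

End Torus.

Record flow (R : realType) := Flow {
  flow_space : metricType R;
  flow_map : flow_space -> flow_space;
  flow_compact : compact [set: flow_space];
  flow_continuous : continuous flow_map
}.

Definition torus_affine_flow (R : realType) (A : 'M[int]_2) (b : torus R) :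
    flow R :=
  Flow (@torus_compact R) (@torus_affine_continuous R A b).

(* e^(i theta) *)
Definition cis (R : realType) (theta : R) : R[i] := cos theta +i* sin theta.

(* Sequences (c_n)_(n >= 1) are functions on nat whose value at 0 is unused. *)
Definition oscillating (R : realType) (c : nat -> R[i]) : Prop :=
  forall t : R, 0 <= t < 1 ->
    (N%:R^-1 * \sum_(1 <= n < N.+1) c n * cis (- (2 * pi * n%:R * t)))
      @[N --> \oo] --> (0 : R[i]).

Definition linearly_disjoint (R : realType) (c : nat -> R[i]) (X : flow R) :
    Prop :=
  forall f : flow_space X -> R[i], continuous f ->
  forall x : flow_space X,
    (N%:R^-1 * \sum_(1 <= n < N.+1) c n * f (iter n (@flow_map R X) x))
      @[N --> \oo] --> (0 : R[i]).

Definition growth_condition (R : realType) (c : nat -> R[i]) (lam : R) : Prop :=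
  (fun N : nat => \sum_(1 <= n < N.+1) Normc.normc (c n) `^ lam : R^o)
    =O_\oo (fun N : nat => N%:R : R^o).

(* Main.v *)
Require Import Defs.
From mathcomp Require Import all_boot all_order all_algebra.
From mathcomp Require Import complex.
From mathcomp Require Import all_classical all_reals all_analysis.
From mathcomp Require Import zify ring lra.
Import Order.TTheory GRing.Theory Num.Theory.
Import numFieldNormedType.Exports.

(** A matrix [A] as in the theorem has finite order: its powers are conjugate
    to the powers of a diagonal matrix with unimodular entries, so they form a
    bounded, hence finite, set of integer matrices, and two of them coincide
    ([unimodular_diagonalizable_finite_order]). If [A ^+ m = 1], then the
    [m]-th iterate of [v |-> A v + b] on the plane is a translation, so the
    lift [v_n] of an orbit satisfies [v_(n + m) = v_n + B]
    ([affine_iter_translation]). Composing the lift with a character of the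
    plane gives a sequence [u] with [u_(n + m) = zeta u_n] for some [zeta] of
    modulus 1. Such a sequence is a finite linear combination of exponentials
    [e^(2 i pi n t)] ([quasi_periodic_trigonometric]), to each of which the
    oscillation hypothesis applies ([quasi_periodic_uncorrelated]).

    To pass from characters to a continuous function [f] one approximates [f]
    uniformly by trigonometric polynomials. The growth condition makes the
    means of [|c_n|] bounded, because [|c| <= 1 + |c| ^ lambda], so that
    uniform limits are harmless ([uniform_limit_uncorrelated]). The
    approximation replaces Fejer's integral by a finite sum over an
    [M] by [M] grid: the values of [f] at the grid points are averaged with
    weights that are products of Fejer kernels, whose total mass is exactly 1
    by orthogonality of the roots of unity. The error is controlled by a
    Korovkin-type argument ([fejer_approximation]): the oscillation of [f]
    between two points is at most [e + K (h + h')], where [h] and [h'] are the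
    squared chords [|1 - e^(2 i pi t)|^2] of the two coordinate differences
    ([torus_chord2_modulus]), and the mean of the squared chord for the Fejer
    weights is at most [4 / M] since multiplying the Dirichlet sum by
    [1 - e^(2 i pi t)] telescopes ([fejer_second_moment]). *)

Set Implicit Arguments.
Unset Strict Implicit.
Unset Printing Implicit Defensive.

Local Open Scope ring_scope.
Local Open Scope complex_scope.

(** * Integer matrices with bounded powers *)

Lemma diag_mxX (F : pzSemiRingType) (n : nat) (d : 'rV[F]_n) (k : nat) :
  diag_mx d ^+ k = diag_mx (\row_i d 0 i ^+ k).
Proof.
elim: k => [|k IH].
  by apply/matrixP => i j; rewrite expr0 !mxE.
rewrite exprS IH; apply/matrixP => i j.
by rewrite [_ * _]mulmx_diag !mxE exprS.
Qed.

(** The powers are [P^-1 D^k P], and the entries of [D^k] have modulus 1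
    whatever [k] is. *)
Lemma diag_powers_bounded (C : numFieldType) (n : nat) (A : 'M[C]_n) :
    diagonalizable A -> (forall z, eigenvalue A z -> `|z| = 1) ->
  exists K : C, forall k i j, `|(A ^+ k) i j| <= K.
Proof.
case=> P Pu /(similar_diagLR Pu)[d Ad] A1.
have Pi : invmx P \in unitmx by rewrite unitmx_inv.
have {}Ad : A = invmx P *m diag_mx d *m P.
  by rewrite Ad conjumx// invmxK.
have d1 l : `|d 0 l| = 1.
  (* the rows of the change of basis are left eigenvectors of A *)
  apply: A1; apply/eigenvalueP; exists (row l P).
    rewrite -row_mul Ad !mulmxA mulmxV// mul1mx row_mul row_diag_mx.
    by rewrite -scalemxAl -rowE.
  apply: contraTneq Pu => Pl0; rewrite -row_free_unit -kermx_eq0.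
  apply/negP => /eqP kP0.
  have : (delta_mx (0 : 'I_1) l <= kermx P)%MS by apply/sub_kermxP; rewrite -rowE.
  rewrite kP0 submx0 => /eqP/matrixP/(_ 0 l)/eqP.
  by rewrite !mxE !eqxx oner_eq0.
have AX k : A ^+ k = invmx P *m (diag_mx d ^+ k) *m P.
  elim: k => [|k IH]; first by rewrite !expr0 mulmx1 mulVmx.
  rewrite !exprS IH -[A * _]/(A *m _) -[diag_mx d * _]/(diag_mx d *m _).
  by rewrite {1}Ad !mulmxA (mulmxK Pu).
exists (\sum_i \sum_j \sum_l `|invmx P i l| * `|P l j|) => k i j.
rewrite (bigD1 i)//= (bigD1 j)//= -addrA ler_wpDr//.
  apply: addr_ge0; first by rewrite sumr_ge0// => *; rewrite sumr_ge0.
  by rewrite sumr_ge0// => *; rewrite sumr_ge0// => *; rewrite sumr_ge0.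
rewrite AX diag_mxX mxE (le_trans (ler_norm_sum _ _ _))// ler_sum// => l _.
by rewrite mul_mx_diag !mxE !normrM normrX d1 expr1n mulr1.
Qed.

(** Only finitely many integer matrices have entries of absolute value at most
    [K], so two powers of [A] agree, and invertibility allows cancelling the smaller. *)
Lemma bounded_powers_finite_order (n : nat) (A : 'M[int]_n) (K : nat) :
    A \in unitmx -> (forall k i j, `|(A ^+ k) i j| <= K%:Z) ->
  exists2 m : nat, (0 < m)%N & A ^+ m = 1.
Proof.
move=> Au AK.
(* shifting the entries by K encodes the powers of A in a finite type *)
pose code (k : nat) : 'M['I_(2 * K).+1]_n :=
  \matrix_(i, j) inord `|((A ^+ k) i j + K%:Z)%R|%N.
have codeK k l : code k = code l -> A ^+ k = A ^+ l.
  move=> /matrixP kl; apply/matrixP => i j.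
  move: (kl i j) (AK k i j) (AK l i j); rewrite !mxE !ler_norml.
  move=> /(congr1 val)/= + /andP[k1 k2] /andP[l1 l2].
  have key (x : int) : - K%:Z <= x -> x <= K%:Z ->
      (`|(x + K%:Z)%R| < (2 * K).+1)%N.
    by move=> x1 x2; rewrite ltnS; lia.
  rewrite !inordK ?key//; lia.
have [m [p [mp Amp]]] : exists m p, (m < p)%N /\ A ^+ m = A ^+ p.
  pose f (k : 'I_(#|'M['I_(2 * K).+1]_n|).+1) := code k.
  have /injectivePn[k [l kl /codeK fkl]] : ~~ injectiveb f.
    by apply/injectiveP => /leq_card; rewrite card_ord ltnn.
  by case: (ltngtP k l) kl => [||/val_inj->]; [exists k, l|exists l, k|rewrite eqxx].
exists (p - m)%N; first lia.
have AmV : A ^+ m \in unitmx.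
  elim: m {mp Amp} => [|m IH]; first exact: unitmx1.
  by rewrite exprS unitmx_mul Au.
have : A ^+ m *m A ^+ (p - m) = A ^+ m *m 1.
  by rewrite mulmx1 {2}Amp -{2}(subnKC (ltnW mp)) exprD.
by move=> /(congr1 (mulmx (invmx (A ^+ m)))); rewrite !mulmxA mulVmx// !mul1mx.
Qed.

(** The case of Kronecker's theorem on algebraic integers all of whose
    conjugates have modulus 1 that concerns eigenvalues of integer matrices:
    these eigenvalues are roots of unity. Diagonalizability excludes unipotent
    parts. *)
Lemma unimodular_diagonalizable_finite_order (R : realType) (n : nat)
    (A : 'M[int]_n) : A \in unitmx ->
    diagonalizable (map_mx intr A : 'M[R[i]]_n) ->
    (forall z : R[i],
       eigenvalue (map_mx intr A : 'M[R[i]]_n) z -> `|z| = 1) ->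
  exists2 m : nat, (0 < m)%N & A ^+ m = 1.
Proof.
move=> Au diagA eigenA.
have [K AK] := @diag_powers_bounded _ _ _ diagA eigenA.
apply: (@bounded_powers_finite_order _ _ (Num.bound (complex.Re K))) => // k i j.
have {}AK : `|((A ^+ k) i j)%:~R : R[i]| <= K.
  by have := AK k i j; rewrite -rmorphXn !mxE.
rewrite -(ler_int R) intr_norm.
have K0 : 0 <= K by apply: le_trans AK.
have AR : `|((A ^+ k) i j)%:~R : R| <= complex.Re K.
  rewrite -lecR (RRe_real (ger0_real K0)).
  by move: AK; rewrite -(rmorph_int (real_complex R)) normc_def /= expr0n addr0 sqrtr_sqr.
by rewrite (le_trans AR)// ltW// archi_boundP// -ler0c (RRe_real (ger0_real K0)).
Qed.

(** * The unit circle *)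

Section UnitCircle.
Variable R : realType.
Implicit Types s t : R.

Definition expi t : R[i] := cis (2 * pi * t).

Lemma expiD s t : expi (s + t) = expi s * expi t.
Proof. by rewrite /expi /cis mulrDr cosD sinD; simpc; congr (_ +i* _); ring. Qed.

Lemma expi0 : expi 0 = 1.
Proof. by rewrite /expi /cis mulr0 cos0 sin0. Qed.

Lemma expi_neq0 t : expi t != 0.
Proof.
apply/eqP => t0; have := expiD t (- t).
by rewrite t0 mul0r subrr expi0 => /eqP; rewrite oner_eq0.
Qed.

Lemma expiN t : expi (- t) = (expi t)^-1.
Proof.
by apply: (mulfI (expi_neq0 t)); rewrite -expiD subrr expi0 divff// expi_neq0.
Qed.

Lemma expiMn (n : nat) t : expi (n%:R * t) = expi t ^+ n.
Proof.
elim: n => [|n IH]; first by rewrite mul0r expi0.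
by rewrite -natr1 mulrDl mul1r expiD IH exprSr.
Qed.

Lemma expi1 : expi 1 = 1.
Proof. by rewrite /expi /cis mulr1 mulr_natl cos2pi sin2pi. Qed.

Lemma expi_nat (n : nat) : expi n%:R = 1.
Proof. by rewrite -[n%:R]mulr1 expiMn expi1 expr1n. Qed.

Lemma expi_int (z : int) : expi z%:~R = 1.
Proof.
case: z => n; first exact: expi_nat.
by rewrite NegzE mulrNz expiN expi_nat invr1.
Qed.

Lemma norm_expi t : `|expi t| = 1.
Proof. by rewrite normc_def /= cos2Dsin2 sqrtr1. Qed.

Lemma expi_conj t : (expi t)^* = expi (- t).
Proof. by rewrite /expi /cis mulrN cosN sinN. Qed.

(** The squared chord between [expi t] and [1]: a smooth substitute for the
    squared distance from [t] to the nearest integer. *)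
Definition chord2 t : R[i] := `|1 - expi t| ^+ 2.

Lemma chord2_ge0 t : 0 <= chord2 t.
Proof. exact: exprn_ge0. Qed.

Lemma chord2E t : chord2 t = (2 - 2 * cos (2 * pi * t))%:C.
Proof.
rewrite /chord2 -add_Re2_Im2 /=; congr _%:C.
have := cos2Dsin2 (2 * pi * t); nra.
Qed.

Lemma chord2_int (z : int) t : chord2 (t + z%:~R) = chord2 t.
Proof. by rewrite /chord2 expiD expi_int mulr1. Qed.

Lemma cos_away (d t : R) : 0 < d -> d <= t -> t <= 1 - d ->
  cos (2 * pi * t) <= cos (2 * pi * d).
Proof.
move=> d0 dt td; have p0 := pi_gt0 R.
have decr x : d <= x -> x <= 2^-1 -> cos (2 * pi * x) <= cos (2 * pi * d).
  move=> dx x2; rewrite leNgt ltr_cos ?in_itv/= -?leNgt; last 2 first.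
  - by apply/andP; split; nra.
  - by apply/andP; split; nra.
  by rewrite ler_pM2l//; nra.
have [|t2] := leP t 2^-1; first exact: decr.
have -> : 2 * pi * t = - (2 * pi * (1 - t)) + pi *+ 2 by rewrite -mulr_natl; ring.
by rewrite cosD2pi cosN; apply: decr; lra.
Qed.

Lemma cos_near0_lt1 (d : R) : 0 < d -> d <= 2^-1 -> cos (2 * pi * d) < 1.
Proof.
move=> d0 d2; have p0 := pi_gt0 R.
rewrite -[ltRHS](@cos0 R) ltr_cos ?in_itv/=; first by nra.
- by apply/andP; split; nra.
- by apply/andP; split; nra.
Qed.

(** By periodicity and monotonicity of the cosine, a point farther than [d]
    from every integer has chord at least that of [d]. *)
Lemma chord2_small_near_int (d t : R) : 0 < d ->
  (exists m : int, `|t - m%:~R| < d) \/ chord2 d <= chord2 t.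
Proof.
move=> d0; pose s := t - (Num.floor t)%:~R.
have /andP[s0 s1] : 0 <= s < 1.
  by rewrite /s; have := floor_itv t; rewrite intrD1; lra.
have [sd|ds] := ltP s d; first by left; exists (Num.floor t); rewrite -/s ger0_norm.
have [sd|sd] := ltP (1 - d) s.
  left; exists (Num.floor t + 1); rewrite intrD1 opprD addrA -/s ltr_norml; lra.
right; have -> : t = s + (Num.floor t)%:~R by rewrite /s subrK.
by rewrite chord2_int !chord2E lecR; have := cos_away d0 ds sd; lra.
Qed.

Lemma chord2_gt0 (d : R) : 0 < d -> d <= 2^-1 -> 0 < chord2 d.
Proof. by move=> d0 d2; rewrite chord2E ltcR; have := cos_near0_lt1 d0 d2; lra. Qed.

(** A geometric sum with ratio an [M]-th root of unity; the bounds on [k] put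
    [k / M] at distance at least [1 / M] from the integers, so the ratio is
    not 1. *)
Lemma sum_roots_of_unity (M : nat) (k : int) : (0 < `|k| < M)%N ->
  \sum_(j < M) expi (k%:~R * (j%:R / M%:R)) = 0.
Proof.
move=> /andP[k0 kM]; have M0 : M%:R != 0 :> R by rewrite pnatr_eq0; lia.
pose z := expi (k%:~R / M%:R).
have z1 : z != 1.
  suff : chord2 (k%:~R / M%:R) != 0.
    by apply: contraNneq => z1; rewrite /chord2 -/z z1 subrr normr0 expr0n.
  have Mgt0 : 0 < M%:R :> R by rewrite lt0r M0 ler0n.
  have kM' : `|k%:~R / M%:R : R| <= 1 - M%:R^-1.
    rewrite normrM normfV (ger0_norm (ltW Mgt0)) ler_pdivrMr// mulrBl mul1r mulVf//.
    rewrite -intr_norm -[`|k|]abszE -pmulrn lerBrDr natr1 ler_nat; lia.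
  have kM'' : M%:R^-1 <= `|k%:~R / M%:R : R|.
    rewrite normrM normfV (ger0_norm (ltW Mgt0)) ler_pdivlMr// mulVf//.
    by rewrite -intr_norm -[`|k|]abszE -pmulrn ler1n.
  have Mi : 0 < M%:R^-1 :> R by rewrite invr_gt0.
  have M2 : M%:R^-1 <= 2^-1 :> R by lra.
  have -> : chord2 (k%:~R / M%:R) = chord2 `|k%:~R / M%:R|.
    by rewrite !chord2E; case: ger0P; rewrite ?mulrN ?cosN.
  rewrite gt_eqF// (lt_le_trans (chord2_gt0 Mi M2))//.
  by rewrite !chord2E lecR; have := cos_away Mi kM'' kM'; lra.
have zM : z ^+ M = 1.
  by rewrite -expiMn mulrCA divff// mulr1 expi_int.
have /esym/eqP := subrX1 z M; rewrite zM subrr mulf_eq0 subr_eq0 (negPf z1)/=.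
by move=> /eqP zs; rewrite -[RHS]zs; apply: eq_bigr => j _; rewrite -expiMn; congr expi; ring.
Qed.

End UnitCircle.

(** * Trigonometric sums and discrete Fejer approximation *)

Section Fejer.
Variable R : realType.

(** Finite Fourier analysis. With [z_j] running through the [m]-th roots of
    [expi theta], the sums [U_j n] of [u (n + r) z_j^(- r)] over one period
    are eigenvectors of the shift with eigenvalue [z_j], hence pure
    exponentials, and by orthogonality they add up to [m u]. *)
Lemma quasi_periodic_trigonometric (u : nat -> R[i]) (m : nat) (theta : R) :
    (0 < m)%N -> (forall n, u (n + m)%N = expi theta * u n) ->
  exists (a : 'I_m -> R[i]) (t : 'I_m -> R),
    forall n, u n = \sum_j a j * expi (n%:R * t j).
Proof.
move=> m0 um; have m0R : m%:R != 0 :> R by rewrite pnatr_eq0; lia.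
pose t (j : 'I_m) : R := (theta + j%:R) / m%:R.
pose U j n := \sum_(r < m) u (n + r)%N * expi (- (r%:R * t j)).
have US j n : U j n.+1 = expi (t j) * U j n.
  pose f r := u (n + r)%N * expi (- (r%:R * t j)).
  have fm : f m = f 0%N.
    rewrite /f um addn0 mul0r oppr0 expi0 mulr1 mulrAC -expiD.
    have -> : theta - m%:R * t j = (- j%:Z)%:~R.
      by rewrite /t mulrNz -pmulrn; field.
    by rewrite expi_int mul1r.
  (* over a whole period, shifting the summation index changes nothing *)
  have shift : \sum_(r < m) f r.+1 = \sum_(r < m) f r.
    apply: (@addrI _ (f 0%N)); rewrite -(big_ord_recl m (fun r => f r)).
    by rewrite big_ord_recr /= fm addrC.
  rewrite /U -/(f _) -shift mulr_sumr; apply: eq_bigr => r _.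
  rewrite /f addSnnS [RHS]mulrCA -expiD; congr (_ * expi _).
  by rewrite -natr1; ring.
have U0 j n : U j n = expi (n%:R * t j) * U j 0%N.
  elim: n => [|n IH]; first by rewrite mul0r expi0 mul1r.
  by rewrite US IH mulrA -expiD -natr1 mulrDl mul1r addrC.
have UE n : m%:R * u n = \sum_j U j n.
  rewrite /U [RHS]exchange_big /= (bigD1 (Ordinal m0))//= [X in _ + X]big1 ?addr0 => [|r r0].
    rewrite (eq_bigr (fun=> u n)) => [|j _]; last first.
      by rewrite /= addn0 mul0r oppr0 expi0 mulr1.
    by rewrite sumr_const card_ord mulr_natl.
  rewrite -mulr_sumr.
  have := @sum_roots_of_unity R m (- r%:Z); rewrite abszN absz_nat ltn_ord andbT.
  rewrite lt0n => /(_ r0) r_sum.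
  rewrite (eq_bigr (fun j : 'I_m => expi (- (r%:R * (theta / m%:R))) *
      expi ((- r%:Z)%:~R * (j%:R / m%:R)))) => [|j _].
    by rewrite -mulr_sumr r_sum !mulr0.
  by rewrite -expiD; congr expi; rewrite /t mulrNz; field.
exists (fun j => U j 0%N / m%:R), t => n.
have m0C : m%:R != 0 :> R[i] by rewrite pnatr_eq0; lia.
apply: (mulfI m0C); rewrite UE mulr_sumr; apply: eq_bigr => j _.
by rewrite U0; field.
Qed.

(** The classical Fejer kernel divided by [M]: the extra factor is the spacing
    of the sampling points [j / M], by which sums replace integrals. *)
Definition fejer (M : nat) (x : R) : R[i] :=
  `|\sum_(k < M) expi (k%:R * x)| ^+ 2 / M%:R ^+ 2.

Lemma fejer_ge0 M x : 0 <= fejer M x.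
Proof. by rewrite divr_ge0 ?exprn_ge0. Qed.

Lemma fejer_expand M x :
  fejer M x = \sum_(k < M) \sum_(l < M) M%:R ^- 2 * expi ((k%:R - l%:R) * x).
Proof.
have conjE : (\sum_(l < M) expi (l%:R * x))^* = \sum_(l < M) expi (- (l%:R * x)).
  by rewrite rmorph_sum; apply: eq_bigr => l _; exact: expi_conj.
rewrite /fejer sqr_normc conjE mulr_suml mulr_suml.
apply: eq_bigr => k _; rewrite mulr_sumr mulr_suml; apply: eq_bigr => l _.
by rewrite mulrC -expiD; congr (_ * expi _); ring.
Qed.

(** The kernel is the squared modulus of a geometric sum with ratio [expi x],
    and [1 - expi x] times that sum telescopes to [1 - expi (M x)]. *)
Lemma fejer_chord2 M x : fejer M x * chord2 x <= 4 / M%:R ^+ 2.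
Proof.
rewrite /fejer /chord2 mulrAC ler_wpM2r ?invr_ge0 ?exprn_ge0//.
rewrite -exprMn -normrM -[4]/(2 * 2)%:R.
have -> : (\sum_(k < M) expi (k%:R * x)) * (1 - expi x) = 1 - expi (M%:R * x).
  rewrite -[RHS]opprB expiMn subrX1 -mulNr opprB mulrC; congr (_ * _).
  by apply: eq_bigr => k _; rewrite expiMn.
rewrite natrM -expr2 lerXn2r ?nnegrE// (le_trans (ler_normB _ _))//.
by rewrite normr1 norm_expi -natr1.
Qed.

(** The frequencies [k - l] of the kernel lie strictly between [- M] and [M],
    so sampling at [M] equidistant points kills all of them but 0. *)
Lemma fejer_partition_of_unity M x : (0 < M)%N ->
  \sum_(j < M) fejer M (x - j%:R / M%:R) = 1.
Proof.
move=> M0; have M0C : M%:R != 0 :> R[i] by rewrite pnatr_eq0; lia.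
under eq_bigr do rewrite fejer_expand.
rewrite exchange_big /= (eq_bigr (fun=> M%:R^-1)) => [|k _].
  by rewrite sumr_const card_ord -[LHS]mulr_natl mulfV.
rewrite exchange_big /= (bigD1 k)//= [X in _ + X]big1 ?addr0 => [|l lk].
  rewrite (eq_bigr (fun=> M%:R ^- 2)) => [|j _]; last by rewrite subrr mul0r expi0 mulr1.
  by rewrite sumr_const card_ord -[LHS]mulr_natl; field.
have lk0 : (0 < `|(l%:Z - k%:Z)%R| < M)%N.
  by have := ltn_ord k; have := ltn_ord l; move: lk; rewrite -val_eqE /=; lia.
rewrite (eq_bigr (fun j : 'I_M => M%:R ^- 2 * expi ((k%:R - l%:R) * x) *
   expi ((l%:Z - k%:Z)%:~R * (j%:R / M%:R)))) => [|j _].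
  by rewrite -mulr_sumr sum_roots_of_unity// mulr0.
by rewrite -mulrA -expiD; congr (_ * expi _); rewrite intrB -!pmulrn; ring.
Qed.

Lemma fejer_second_moment M x : (0 < M)%N ->
  \sum_(j < M) fejer M (x - j%:R / M%:R) * chord2 (x - j%:R / M%:R)
    <= 4 / M%:R.
Proof.
move=> M0; have M0C : M%:R != 0 :> R[i] by rewrite pnatr_eq0; lia.
rewrite (le_trans (ler_sum _ (fun j _ => fejer_chord2 M _)))//.
rewrite sumr_const card_ord -[leLHS]mulr_natl le_eqVlt; apply/orP; left.
by apply/eqP; field.
Qed.

(** Averaging against product weights of mass 1 costs no more than the mean of
    the pointwise error; here that error separates into a function of [i] and
    a function of [j], so only the one-dimensional means enter. *)
Lemma product_mean_approximation (C : numFieldType) (I J : finType)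
    (w g : I -> C) (v h : J -> C) (p : I -> J -> C) (z e K a b : C) :
    (forall i, 0 <= w i) -> (forall j, 0 <= v j) ->
    \sum_i w i = 1 -> \sum_j v j = 1 -> 0 <= K ->
    (forall i j, `|z - p i j| <= e + K * (g i + h j)) ->
    \sum_i w i * g i <= a -> \sum_j v j * h j <= b ->
  `|z - \sum_i \sum_j p i j * (w i * v j)| <= e + K * (a + b).
Proof.
move=> w0 v0 w1 v1 K0 zp wa vb.
have wv1 x : x = \sum_i \sum_j x * (w i * v j).
  rewrite -[LHS]mulr1 -[X in _ * X]mulr1 -{1}w1 -v1 mulr_suml mulr_sumr.
  by apply: eq_bigr => i _; rewrite !mulr_sumr.
rewrite [X in `|X - _|]wv1 -sumrB.
apply: (@le_trans _ _ (\sum_i \sum_j (e + K * (g i + h j)) * (w i * v j))).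
  rewrite (le_trans (ler_norm_sum _ _ _))// ler_sum// => i _.
  rewrite -sumrB (le_trans (ler_norm_sum _ _ _))// ler_sum// => j _.
  have wv0 : 0 <= w i * v j by rewrite mulr_ge0.
  by rewrite -mulrBl normrM (ger0_norm wv0) ler_wpM2r.
have -> : \sum_i \sum_j (e + K * (g i + h j)) * (w i * v j) =
    e + K * (\sum_i w i * g i + \sum_j v j * h j).
  transitivity (\sum_i (w i * e + K * (w i * g i)
      + w i * (K * \sum_j v j * h j))).
    apply: eq_bigr => i _; rewrite -[w i * e]mulr1 -[K * (w i * _)]mulr1 -v1.
    by rewrite !mulr_sumr -!big_split /=; apply: eq_bigr => j _; ring.
  by rewrite !big_split /= -!mulr_suml -mulr_sumr w1; ring.
by rewrite lerD2l ler_wpM2l// lerD.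
Qed.

(** The weights concentrate at the sampling points close to [(x, y)], as
    measured by the squared chord: its mean is at most [4 / M] in each
    coordinate, and the hypothesis bounds the error by these two means. *)
Lemma fejer_approximation (phi : R -> R -> R[i]) (e K : R[i]) M x y :
    (0 < M)%N -> 0 <= K ->
    (forall x' y', `|phi x y - phi x' y'| <=
       e + K * (chord2 (x - x') + chord2 (y - y'))) ->
  `|phi x y - \sum_(i < M) \sum_(j < M) phi (i%:R / M%:R) (j%:R / M%:R) *
      (fejer M (x - i%:R / M%:R) * fejer M (y - j%:R / M%:R))|
    <= e + 8 * K / M%:R.
Proof.
move=> M0 K0 phiK.
have -> : e + 8 * K / M%:R = e + K * (4 / M%:R + 4 / M%:R).
  by congr (_ + _); rewrite [8](natrD _ 4 4); ring.
apply: product_mean_approximation => [i|j|||//|i j||].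
- exact: fejer_ge0.
- exact: fejer_ge0.
- exact: fejer_partition_of_unity.
- exact: fejer_partition_of_unity.
- exact: phiK.
- exact: fejer_second_moment.
- exact: fejer_second_moment.
Qed.

End Fejer.

(** * Sequences uncorrelated with an oscillating sequence *)

Section Averages.
Local Open Scope classical_set_scope.
Local Open Scope ring_scope.
Variable R : realType.
Implicit Types (c u : nat -> R[i]) (e K : R[i]) (n N : nat).

Definition average u N : R[i] := N%:R^-1 * \sum_(1 <= n < N.+1) u n.

(** Linear disjointness of [c] from a flow says that [c] is uncorrelated with
    every continuous function read along an orbit. *)
Definition uncorrelated c u : Prop :=
  average (fun n => c n * u n) N @[N --> \oo] --> (0 : R[i]).

Lemma uncorrelatedP c u : uncorrelated c u <->
  forall e, 0 < e -> \forall N \near \oo, `|average (fun n => c n * u n) N| < e.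
Proof.
split=> [/cvgrPdist_lt cu e /cu|cu].
  by apply: filterS => N; rewrite sub0r normrN.
apply/cvgrPdist_lt => e /cu.
by apply: filterS => N; rewrite sub0r normrN.
Qed.

Lemma eq_uncorrelated c u v : u =1 v -> uncorrelated c u -> uncorrelated c v.
Proof. by move=> /funext ->. Qed.

Lemma uncorrelatedMl c u (a : R[i]) :
  uncorrelated c u -> uncorrelated c (fun n => a * u n).
Proof.
move=> /uncorrelatedP cu; apply/uncorrelatedP => e e0.
have a1 : 0 < `|a| + 1 by rewrite ltr_wpDl.
have := cu (e / (`|a| + 1)); rewrite divr_gt0// => /(_ isT).
apply: filterS => N cuN.
have -> : average (fun n => c n * (a * u n)) N =
    a * average (fun n => c n * u n) N.
  rewrite /average mulrCA; congr (_ * _); rewrite mulr_sumr.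
  by apply: eq_bigr => n _; rewrite mulrCA.
rewrite normrM -[e](divfK (lt0r_neq0 a1)) [ltRHS]mulrC.
by rewrite (@le_lt_trans _ _ ((`|a| + 1) * `|average (fun n => c n * u n) N|))//;
  [rewrite ler_wpM2r// lerDl|rewrite ltr_pM2l].
Qed.

Lemma uncorrelatedD c u v :
  uncorrelated c u -> uncorrelated c v -> uncorrelated c (fun n => u n + v n).
Proof.
move=> cu cv; rewrite /uncorrelated -[0]addr0.
apply: cvg_trans (cvgD cu cv); apply: near_eq_cvg; near=> N.
rewrite -[LHS]/(average (fun n => c n * u n) N + average (fun n => c n * v n) N).
rewrite /average -mulrDr -big_split /=; congr (_ * _).
by apply: eq_bigr => n _; rewrite mulrDr.
Unshelve. all: by end_near.
Qed.

Lemma uncorrelated_sum c (I : Type) (s : seq I) (u : I -> nat -> R[i]) :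
  (forall i, uncorrelated c (u i)) -> uncorrelated c (fun n => \sum_(i <- s) u i n).
Proof.
move=> cu; elim: s => [|i s IH].
  apply/uncorrelatedP => e e0; near=> N.
  by rewrite /average big1 ?mulr0 ?normr0// => n _; rewrite big_nil mulr0.
apply: (@eq_uncorrelated _ (fun n => u i n + \sum_(i <- s) u i n)).
  by move=> n; rewrite big_cons.
exact: uncorrelatedD.
Unshelve. all: by end_near.
Qed.

(** The hypothesis is about frequencies [t] with [0 <= t < 1] and exponentials
    of the opposite sign, but the exponential depends on the frequency modulo 1 only. *)
Lemma oscillating_uncorrelated c (t : R) :
  oscillating c -> uncorrelated c (fun n => expi (n%:R * t)).
Proof.
move=> osc_c; pose s : R := - t - (Num.floor (- t))%:~R.
have /osc_c : 0 <= s < 1.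
  by rewrite /s; have := floor_itv (- t); rewrite intrD1; lra.
have cisE n : cis (- (2 * pi * n%:R * s)) = expi (n%:R * t).
  rewrite -[RHS]mulr1 -(expi_int R (n%:Z * Num.floor (- t))) -expiD /expi.
  by congr cis; rewrite intrM -pmulrn /s; ring.
by under eq_fun do under eq_bigr do rewrite cisE.
Qed.

Lemma quasi_periodic_uncorrelated c u (m : nat) (theta : R) :
    oscillating c -> (0 < m)%N -> (forall n, u (n + m)%N = expi theta * u n) ->
  uncorrelated c u.
Proof.
move=> osc_c m0 /(quasi_periodic_trigonometric m0)[a [t ut]].
apply: (@eq_uncorrelated _ (fun n => \sum_j a j * expi (n%:R * t j))) => //.
apply: uncorrelated_sum => j.
exact: uncorrelatedMl (oscillating_uncorrelated (t j) osc_c).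
Qed.

Lemma uniform_limit_uncorrelated c u K : 0 <= K ->
    (\forall N \near \oo, average (fun n => `|c n|) N <= K) ->
    (forall e, 0 < e -> exists2 v, uncorrelated c v &
       forall n, `|u n - v n| <= e) ->
  uncorrelated c u.
Proof.
move=> K0 cK uv; apply/uncorrelatedP => e e0.
have K1 : 0 < K + 1 by rewrite ltr_wpDl.
have e2 : 0 < e / 2 by rewrite divr_gt0.
have [|v /uncorrelatedP/(_ _ e2) cv uve] := uv (e / 2 / (K + 1)).
  by rewrite divr_gt0.
near=> N.
have -> : average (fun n => c n * u n) N =
    average (fun n => c n * v n) N + average (fun n => c n * (u n - v n)) N.
  rewrite /average -mulrDr -big_split; congr (_ * _); apply: eq_bigr => n _ /=.
  by rewrite -mulrDr addrC subrK.
rewrite (le_lt_trans (ler_normD _ _))// (splitr e) ltr_leD//; first by near: N.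
rewrite /average normrM normfV normr_nat.
apply: (@le_trans _ _ ((e / 2 / (K + 1)) * K)); last first.
  by rewrite mulrAC ler_pdivrMr// ler_wpM2l ?(ltW e2)// lerDl.
apply: (@le_trans _ _ ((e / 2 / (K + 1)) * average (fun n => `|c n|) N)); last first.
  by apply: ler_wpM2l; [rewrite divr_ge0 ?ltW|near: N].
rewrite /average mulrCA ler_wpM2l ?invr_ge0// mulr_sumr.
rewrite (le_trans (ler_norm_sum _ _ _))// ler_sum// => n _.
by rewrite normrM mulrC ler_wpM2r.
Unshelve. all: by end_near.
Qed.

(** Since the exponent is at least 1, [|c| <= |c| ^ lam + 1] termwise. *)
Lemma growth_condition_average_bounded c (lam : R) : 1 < lam ->
  growth_condition c lam ->
  exists2 K : R[i], 0 <= K & \forall N \near \oo, average (fun n => `|c n|) N <= K.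
Proof.
move=> lam1 /eqO_exP[k /= k0 ck]; exists (k + 1)%:C; first by rewrite ler0c addr_ge0// ltW.
near=> N.
have N0 : (0 < N)%N by near: N; exact: nbhs_infty_gt.
have := near ck N; rewrite /average; move=> /(_ _)/wrap[]//.
rewrite !ger0_norm//; last first.
  by rewrite sumr_ge0// => n _; exact: powR_ge0.
move=> ckN.
rewrite mulrC ler_pdivrMr ?ltr0n//.
have -> : \sum_(1 <= n < N.+1) `|c n| =
    (\sum_(1 <= n < N.+1) Normc.normc (c n))%:C by rewrite rmorph_sum.
have -> : (k + 1)%:C * N%:R = ((k + 1) * N%:R)%:C :> R[i] by rewrite rmorphM rmorph_nat.
rewrite lecR mulrDl mul1r.
apply: (@le_trans _ _ (\sum_(1 <= n < N.+1) (Normc.normc (c n) `^ lam + 1))).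
  apply: ler_sum => n _; have c0 : 0 <= Normc.normc (c n) by case: (c n) => ? ?; exact: sqrtr_ge0.
  have [c1|c1] := leP (Normc.normc (c n)) 1.
    by rewrite ler_wpDl// powR_ge0.
  by rewrite ler_wpDr// -{1}[Normc.normc _]powRr1// ler_powR// ltW.
by rewrite big_split /= big_const_nat subn1 /= iter_addr_0 lerD2r.
Unshelve. all: by end_near.
Qed.

End Averages.

(** * Continuous functions on the torus *)

Section Compactness.
Local Open Scope classical_set_scope.
Local Open Scope ring_scope.
Variables (R : realType) (X : metricType R) (f : X -> R[i]).
Hypotheses (X_compact : compact [set: X]) (f_continuous : continuous f).

(** Local boundedness and compactness, in the near-covering form: a property
    of [(x, B)] that holds near each [x] for all large [B] holds for all [x]
    at once for some [B]. *)
Lemma compact_continuous_bounded :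
  exists2 B : R[i], 0 <= B & forall x, `|f x| <= B.
Proof.
have cov := (iffLR (compact_near_coveringP _)) X_compact.
have /cov fB : forall x, [set: X] x ->
    \forall x' \near x & B \near +oo%R, `|f x'| <= B%:C.
  move=> x _; near=> x' B.
  have xx' : `|f x - f x'| < 1.
    by near: x'; exact: (iffLR (cvgrPdist_lt _ _) (@f_continuous x) 1 ltr01).
  have xB : `|f x| + 1 <= B%:C.
    rewrite -(RRe_real (normr_real (f x))) -(rmorph1 (real_complex R)) -rmorphD lecR.
    by near: B; apply: nbhs_pinfty_ge; exact: num_real.
  apply: le_trans xB; rewrite -[f x'](subrK (f x)) addrC.
  by rewrite (le_trans (ler_normD _ _))// lerD2l distrC ltW.
have := filter_ex (filterI fB (nbhs_pinfty_ge (num_real (0 : R)))).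
move=> [B [fB' B0]]; exists B%:C; first by rewrite ler0c.
by move=> x; exact: fB'.
Unshelve. all: by end_near.
Qed.

(** The Heine-Cantor theorem. The metric of [X] takes values in [R] and the
    norm of [R[i]] in [R[i]], so this is not uniform continuity between two
    pseudometric spaces over the same field. *)
Lemma compact_unif_continuous (e : R[i]) : 0 < e ->
  exists2 d : R, 0 < d & forall x y, mdist x y < d -> `|f x - f y| < e.
Proof.
move=> e0; have cov := (iffLR (compact_near_coveringP _)) X_compact.
have /cov fd : forall x, [set: X] x -> \forall x' \near x & d \near (0 : R)^'+,
    forall y, mdist x' y < d -> `|f x' - f y| < e.
  move=> x _.
  have e2 : 0 < e / 2 by rewrite divr_gt0.
  have fx := iffLR (cvgrPdist_lt _ _) (@f_continuous x) _ e2.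
  have [r /= r0 xr] := iffLR (metricType_numDomainType.nbhs_mdistP _ _) (fx _).
  have r2 : 0 < r / 2 by rewrite divr_gt0.
  near=> x' d => y /= x'y.
  have xx' : mdist x x' < r / 2.
    near: x'; apply/metricType_numDomainType.nbhs_mdistP.
    by exists (r / 2).
  have dr : d < r / 2 by near: d; exact: nbhs_right_lt.
  have xy : mdist x y < r.
    have := metric_triangle x x' y; lra.
  have xx'r : mdist x x' < r by lra.
  rewrite (splitr e) -[f x'](subrK (f x)) -addrA.
  by rewrite (le_lt_trans (ler_normD _ _))// ltrD ?xr// distrC xr.
have := filter_ex (filterI fd (nbhs_right_gt 0)).
by move=> [d [fd' d0]]; exists d => // x y; exact: fd'.
Unshelve. all: by end_near.
Qed.

End Compactness.

Section TorusApproximation.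
Local Open Scope quotient_scope.
Local Open Scope ring_scope.
Variable R : realType.

Definition torus_point (x y : R) : torus R :=
  \pi_(torus R) (\col_i (if i == 0 then x else y)).

Lemma torus_point_lift (v : 'cV[R]_2) : torus_point (v 0 0) (v 1 0) = \pi_(torus R) v.
Proof.
congr \pi_(torus R); apply/colP => i; rewrite mxE.
by case: i => -[|[|//]] i2 /=; congr (v _ _); exact: val_inj.
Qed.

(** The integers [m] and [p] select a lift of the second point close to the
    lift of the first. *)
Lemma torus_point_dist (x y x' y' : R) (m p : int) :
  mdist (torus_point x y) (torus_point x' y') <=
    `|x - x' - m%:~R| + `|y - y' - p%:~R|.
Proof.
have -> : torus_point x' y' = torus_point (x' + m%:~R) (y' + p%:~R).
  apply/torus_pi_eqP/forallP => i; rewrite !mxE.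
  by case: ifP => _; rewrite opprD addNKr rpredN intr_int.
rewrite (le_trans (torus_mdist_pi_le _ _))// (le_trans (euclid_norm_le _))//.
by rewrite !mxE /= !opprD !addrA.
Qed.

(** Two points whose coordinates differ by nearly integers are close in the
    torus, and uniform continuity applies; otherwise one squared chord is
    bounded below and a large [K] absorbs the trivial bound [2 B]. *)
Lemma torus_chord2_modulus (f : torus R -> R[i]) (e : R[i]) :
    continuous f -> 0 < e ->
  exists2 K : R[i], 0 <= K & forall x y x' y',
    `|f (torus_point x y) - f (torus_point x' y')| <=
      e + K * (chord2 (x - x') + chord2 (y - y')).
Proof.
move=> fc e0; have Tc := @torus_compact R.
have [B B0 fB] := compact_continuous_bounded Tc fc.
have [d d0 fd] := compact_unif_continuous Tc fc e0.
pose r := Num.min (d / 2) 2^-1.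
have r0 : 0 < r by rewrite lt_min divr_gt0//= invr_gt0.
have rd : r <= d / 2 by rewrite ge_min lexx.
have r2 : r <= 2^-1 by rewrite ge_min lexx orbT.
have h0 := chord2_gt0 r0 r2.
exists (2 * B / chord2 r); first by rewrite divr_ge0 ?mulr_ge0// ltW.
move=> x y x' y'.
have far : chord2 r <= chord2 (x - x') + chord2 (y - y') ->
    `|f (torus_point x y) - f (torus_point x' y')| <=
      e + 2 * B / chord2 r * (chord2 (x - x') + chord2 (y - y')).
  move=> rh; apply: (@le_trans _ _ (2 * B)).
    by rewrite (le_trans (ler_normB _ _))// mulr_natl mulr2n lerD.
  rewrite ler_wpDl ?(ltW e0)// mulrAC ler_pdivlMr// ler_wpM2l// mulr_ge0//.
have [[m xm]|xr] := chord2_small_near_int (x - x') r0; last first.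
  by apply: far; rewrite ler_wpDr// chord2_ge0.
have [[p yp]|yr] := chord2_small_near_int (y - y') r0; last first.
  by apply: far; rewrite ler_wpDl// chord2_ge0.
rewrite ler_wpDr//; first by rewrite mulr_ge0 ?addr_ge0 ?chord2_ge0// divr_ge0 ?mulr_ge0// ltW.
rewrite ltW// fd// (le_lt_trans (torus_point_dist _ _ _ _ m p))//; lra.
Qed.

Lemma torus_affine_lift (A : 'M[int]_2) (b v : 'cV[R]_2) (n : nat) :
  iter n (torus_affine A (\pi_(torus R) b)) (\pi_(torus R) v) =
  \pi_(torus R) (iter n (fun w => map_mx intr A *m w + b) v).
Proof.
elim: n => //= n ->.
by rewrite /torus_affine torus_mulmx_pi torus_piD.
Qed.

End TorusApproximation.

(** * Orbits of affine maps of finite order *)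

(** The linear part of the [m]-th iterate of an affine map is [A ^+ m = 1], so
    this iterate is a translation. *)
Lemma affine_iter_translation (F : pzRingType) (d : nat) (A : 'M[F]_d)
    (b : 'cV[F]_d) (m : nat) : A ^+ m = 1 ->
  exists B : 'cV[F]_d, forall n v,
    iter (n + m) (fun w => A *m w + b) v = iter n (fun w => A *m w + b) v + B.
Proof.
move=> Am; pose S w := A *m w + b; exists (iter m S 0) => n v.
have SE k w : iter k S w = A ^+ k *m w + iter k S 0.
  elim: k => [|k IH]; first by rewrite expr0 mul1mx addr0.
  by rewrite !iterS IH {1}/S mulmxDr mulmxA -addrA exprS.
by rewrite addnC iterD -[LHS]/(iter m S _) SE Am mul1mx.
Qed.

Section Orbits.
Local Open Scope classical_set_scope.
Local Open Scope quotient_scope.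
Local Open Scope ring_scope.
Variable R : realType.

(** Expanding both kernels gives a combination of exponentials of affine
    functions of [v n], and the relation on [v] makes each of them
    quasi-periodic. *)
Lemma fejer_product_uncorrelated (c : nat -> R[i]) (v : nat -> 'cV[R]_2)
    (m M : nat) (B : 'cV[R]_2) (x y : R) :
    oscillating c -> (0 < m)%N -> (forall n, v (n + m)%N = v n + B) ->
  uncorrelated c (fun n => fejer M (v n 0 0 - x) * fejer M (v n 1 0 - y)).
Proof.
move=> osc_c m0 vm.
pose mode (k l k' l' : 'I_M) n : R[i] := M%:R ^- 2 * (M%:R ^- 2 *
  expi ((k%:R - l%:R) * (v n 0 0 - x) + (k'%:R - l'%:R) * (v n 1 0 - y))).
apply: (@eq_uncorrelated _ _ (fun n =>
    \sum_k \sum_l \sum_k' \sum_l' mode k l k' l' n)) => [n|].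
  rewrite !fejer_expand mulr_suml; apply: eq_bigr => k _.
  rewrite mulr_suml; apply: eq_bigr => l _.
  rewrite mulr_sumr; apply: eq_bigr => k' _.
  rewrite mulr_sumr; apply: eq_bigr => l' _.
  by rewrite /mode expiD; ring.
apply: uncorrelated_sum => k; apply: uncorrelated_sum => l.
apply: uncorrelated_sum => k'; apply: uncorrelated_sum => l'.
do 2 apply: uncorrelatedMl.
apply: (@quasi_periodic_uncorrelated _ _ _ m
  ((k%:R - l%:R) * B 0 0 + (k'%:R - l'%:R) * B 1 0)) => // n.
by rewrite -expiD vm !mxE; congr expi; ring.
Qed.

Lemma torus_orbit_uncorrelated (c : nat -> R[i]) (K : R[i]) (f : torus R -> R[i])
    (v : nat -> 'cV[R]_2) (m : nat) (B : 'cV[R]_2) :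
    oscillating c -> 0 <= K ->
    (\forall N \near \oo, average (fun n => `|c n|) N <= K) ->
    continuous f -> (0 < m)%N -> (forall n, v (n + m)%N = v n + B) ->
  uncorrelated c (fun n => f (\pi_(torus R) (v n))).
Proof.
move=> osc_c K0 cK fc m0 vm; apply: (uniform_limit_uncorrelated K0 cK) => e e0.
have e2 : 0 < e / 2 by rewrite divr_gt0.
have [L L0 fL] := torus_chord2_modulus fc e2.
have [M M0 LM] : exists2 M : nat, (0 < M)%N & 8 * L / M%:R <= e / 2.
  pose M := (Num.bound (complex.Re (8 * L / (e / 2)))).+1; exists M => //.
  have z0 : 0 <= 8 * L / (e / 2) by rewrite divr_ge0 ?mulr_ge0// ltW.
  rewrite ler_pdivrMr ?ltr0n// [leRHS]mulrC -ler_pdivrMr//.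
  rewrite -(RRe_real (ger0_real z0)) -(rmorph_nat (real_complex R) M) lecR.
  by rewrite -[leRHS]natr1 ler_wpDr// ltW// archi_boundP// -ler0c (RRe_real (ger0_real z0)).
pose phi x y := f (torus_point x y).
exists (fun n => \sum_(i < M) \sum_(j < M) phi (i%:R / M%:R) (j%:R / M%:R) *
    (fejer M (v n 0 0 - i%:R / M%:R) * fejer M (v n 1 0 - j%:R / M%:R))).
  apply: uncorrelated_sum => i; apply: uncorrelated_sum => j.
  by apply: uncorrelatedMl; exact: fejer_product_uncorrelated vm.
move=> n; rewrite -torus_point_lift -/(phi _ _).
rewrite (le_trans (@fejer_approximation _ phi (e / 2) L _ _ _ M0 L0 (fL _ _)))//.
by rewrite [leRHS]splitr lerD2l.
Qed.

End Orbits.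

Theorem corollary7 (R : realType) (A : 'M[int]_2)
    (det_A : \det A = 1 \/ \det A = -1)
    (diag_A : diagonalizable (map_mx intr A : 'M[R[i]]_2))
    (eigen_A : forall z : R[i],
       eigenvalue (map_mx intr A : 'M[R[i]]_2) z -> `|z| = 1)
    (c : nat -> R[i])
    (osc_c : oscillating c)
    (growth_c : exists2 lam : R, 1 < lam & growth_condition c lam)
    (b : torus R) :
  linearly_disjoint c (torus_affine_flow A b).
Proof.
have [m m0 Am] : exists2 m : nat, (0 < m)%N & A ^+ m = 1.
  apply: unimodular_diagonalizable_finite_order diag_A eigen_A.
  by rewrite unitmxE; case: det_A => ->.
have [lam lam1 c_lam] := growth_c.
have [K K0 cK] := growth_condition_average_bounded lam1 c_lam.
have AmR : (map_mx intr A : 'M[R]_2) ^+ m = 1 by rewrite -rmorphXn Am rmorph1.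
have [B vB] := affine_iter_translation (repr b) AmR.
move=> f fc x.
have := torus_orbit_uncorrelated osc_c K0 cK fc m0 (fun n => vB n (repr x)).
apply: eq_uncorrelated => n.
by rewrite -torus_affine_lift !reprK.
Qed.
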